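(* Let $A\in\mathbb{R}^{n\times n}$ be an $H_+$-matrix, let $q\in\mathbb{R}^n$, and let $A=M-N$ be a splitting of $A$ with $M,N\in\mathbb{R}^{n\times n}$. Let $\Omega_1,\Omega_2\in\mathbb{R}^{n\times n}$, let $\gamma>0$, let $\Omega_4$ be a positive diagonal matrix, and define $$B=M+\Omega_1-\Omega_2+\gamma\Omega_4,\qquad C=N+\Omega_1-\Omega_2,\qquad G=\gamma\Omega_4-A.$$ Assume that $B$ is an $H$-matrix. If there exists a vector $w\in\mathbb{R}^n$ with $w>0$ such that $$(|C|+|G|)w<\langle B\rangle w,$$ then the relaxed shifted matrix-splitting modulus-based iteration method converges to the unique solution of $\operatorname{LCP}(q,A)$ for every initial vector $x^{(0)}\in\mathbb{R}^n$.
   Context: For $A\in\mathbb{R}^{n\times n}$ and $q\in\mathbb{R}^n$, $\operatorname{LCP}(q,A)$ is the problem of finding $z,w\in\mathbb{R}^n$ with $w=Az+q$, $z\ge 0$, $w\ge 0$, $z^Tw=0$; $z$ is referred to as the solution. All inequalities between vectors or matrices are entrywise (strict inequality means strict in every entry), and $|X|$ denotes the entrywise absolute value. A positive diagonal matrix is a diagonal matrix with positive diagonal entries. The comparison matrix $\langle X\rangle$ of $X=(x_{ij})\in\mathbb{R}^{n\times n}$ is defined by $\langle X\rangle_{ii}=|x_{ii}|$ and $\langle X\rangle_{ij}=-|x_{ij}|$ for $i\ne j$. A $Z$-matrix is a real square matrix with non-positive off-diagonal entries; a nonsingular $M$-matrix is a nonsingular $Z$-matrix $X$ with $X^{-1}\ge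 0$. $X$ is an $H$-matrix if $\langle X\rangle$ is a nonsingular $M$-matrix, and an $H_+$-matrix if in addition its diagonal entries are positive. Relaxed shifted matrix-splitting modulus-based iteration method: given $x^{(0)}\in\mathbb{R}^n$, compute for $k=0,1,2,\ldots$ $$(M+\Omega_1-\Omega_2+\gamma\Omega_4)x^{(k+1)}=(N+\Omega_1-\Omega_2)x^{(k)}+(\gamma\Omega_4-A)|x^{(k)}|-\gamma q,$$ $$z^{(k+1)}=\frac1\gamma\left(|x^{(k+1)}|+x^{(k+1)}\right).$$ The method ''converges to the unique solution of $\operatorname{LCP}(q,A)$'' means that the coefficient matrix $M+\Omega_1-\Omega_2+\gamma\Omega_4$ is nonsingular (so the iteration is well defined), the sequence $x^{(k)}$ converges, and $z^{(k)}$ converges to the unique solution $z^\ast$ of $\operatorname{LCP}(q,A)$. *)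

(* Defs.v *)
From mathcomp Require Import all_boot all_order all_algebra.
From mathcomp Require Import all_classical all_reals all_analysis.

Set Implicit Arguments.
Unset Strict Implicit.
Unset Printing Implicit Defensive.

Import Order.TTheory GRing.Theory Num.Theory.
Import numFieldNormedType.Exports.

Local Open Scope classical_set_scope.
Local Open Scope ring_scope.

Section MatrixNotions.
Variable R : realType.

Definition mx_le (m n : nat) (X Y : 'M[R]_(m, n)) : Prop :=
  forall i j, X i j <= Y i j.

Definition mx_lt (m n : nat) (X Y : 'M[R]_(m, n)) : Prop :=
  forall i j, X i j < Y i j.

(* Entrywise; the notation `|X| on matrices would be the (scalar) sup norm. *)
Definition mx_abs (m n : nat) (X : 'M[R]_(m, n)) : 'M[R]_(m, n) :=
  map_mx (fun a : R => `|a|) X.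

Definition positive_diagonal (n : nat) (D : 'M[R]_n) : Prop :=
  is_diag_mx D /\ forall i, 0 < D i i.

Definition comparison_mx (n : nat) (X : 'M[R]_n) : 'M[R]_n :=
  \matrix_(i, j) (if i == j then `|X i j| else - `|X i j|).

Definition Z_matrix (n : nat) (X : 'M[R]_n) : Prop :=
  forall i j, i != j -> X i j <= 0.

Definition nonsingular_M_matrix (n : nat) (X : 'M[R]_n) : Prop :=
  [/\ Z_matrix X, X \in unitmx & mx_le 0 (invmx X)].

Definition H_matrix (n : nat) (X : 'M[R]_n) : Prop :=
  nonsingular_M_matrix (comparison_mx X).

Definition Hplus_matrix (n : nat) (X : 'M[R]_n) : Prop :=
  H_matrix X /\ forall i, 0 < X i i.

Definition LCP_solution (n : nat) (q : 'cV[R]_n) (A : 'M[R]_n)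
    (z : 'cV[R]_n) : Prop :=
  exists w : 'cV[R]_n,
    [/\ w = A *m z + q, mx_le 0 z, mx_le 0 w & z^T *m w = 0].

(* z 0 is left unconstrained: the method only produces z^(k) for k >= 1. *)
Definition RSMSM_iterates (n : nat) (A M N O1 O2 O4 : 'M[R]_n) (g : R)
    (q x0 : 'cV[R]_n) (x z : nat -> 'cV[R]_n) : Prop :=
  [/\ x 0%N = x0,
      forall k, (M + O1 - O2 + g *: O4) *m x k.+1 =
                (N + O1 - O2) *m x k + (g *: O4 - A) *m mx_abs (x k) - g *: q
    & forall k, z k.+1 = g^-1 *: (mx_abs (x k.+1) + x k.+1)].

(* The first conjunct makes the sequence of iterates exist and be unique. *)
Definition RSMSM_converges (n : nat) (A M N O1 O2 O4 : 'M[R]_n) (g : R)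
    (q x0 : 'cV[R]_n) : Prop :=
  M + O1 - O2 + g *: O4 \in unitmx /\
  exists zstar : 'cV[R]_n,
    unique (LCP_solution q A) zstar /\
    forall x z : nat -> 'cV[R]_n,
      RSMSM_iterates A M N O1 O2 O4 g q x0 x z ->
      (exists xstar : 'cV[R]_n, x k @[k --> \oo] --> xstar) /\
      z k @[k --> \oo] --> zstar.

End MatrixNotions.

(* Main.v *)
(* Writing B x' = C x + G |x| - g q for the iteration map x |-> x', the
   inequality <B> |e| <= |B e| and <B>^-1 >= 0 turn (|C| + |G|) w <= r <B> w
   into: |x - y| <= t w implies |x' - y'| <= r t w.  So x |-> x' is an
   r-contraction for the norm max_i |v_i| / w_i, with r < 1.  Its unique fixed
   point x corresponds to the unique solution of the LCP by
   z = (|x| + x) / g and A z + q = O4 (|x| - x). *)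

Require Import Defs.
From mathcomp Require Import all_boot all_order all_algebra.
From mathcomp Require Import all_classical all_reals all_analysis.
From mathcomp Require Import ring lra.
Import Order.TTheory GRing.Theory Num.Theory.
Import numFieldNormedType.Exports.
Local Open Scope ring_scope.

Set Implicit Arguments.
Unset Strict Implicit.
Unset Printing Implicit Defensive.

(** * Comparison matrices and entrywise estimates *)

Section ComparisonMatrix.
Variables (R : realType) (n : nat).
Implicit Types (B : 'M[R]_n) (u v d w : 'cV[R]_n) (t : R).

Lemma comparison_mulmxE B v i :
  (comparison_mx B *m v) i 0 =
  `|B i i| * v i 0 - \sum_(j | j != i) `|B i j| * v j 0.
Proof.
rewrite mxE (bigD1 i) //= mxE eqxx -sumrN; congr (_ + _).
by apply: eq_bigr => j ji; rewrite mxE eq_sym (negbTE ji) mulNr.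
Qed.

(** In each row, the reverse triangle inequality separates the diagonal term from the off-diagonal
    sum. *)
Lemma comparison_abs_le B v :
  mx_le (comparison_mx B *m mx_abs v) (mx_abs (B *m v)).
Proof.
move=> i j; rewrite ord1 comparison_mulmxE !mxE [X in _ <= `|X|](bigD1 i) //= -normrM.
rewrite (le_trans _ (lerB_normD _ _))// lerB// (le_trans (ler_norm_sum _ _ _))//.
by apply: ler_sum => k _; rewrite mxE normrM.
Qed.

Lemma H_matrix_le B u v : H_matrix B ->
  mx_le (comparison_mx B *m u) (comparison_mx B *m v) -> mx_le u v.
Proof.
move=> [_ Bu Bi] uv i j; rewrite -(mulKmx Bu u) -(mulKmx Bu v).
rewrite mxE [leRHS]mxE; apply: ler_sum => k _; apply: ler_wpM2l => //.
by have := Bi i k; rewrite mxE.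
Qed.

(** If [B v = 0], then [comparison_mx B *m mx_abs v <= 0], and monotonicity of the inverse gives
    [mx_abs v <= 0]. *)
Lemma H_matrix_unit B : H_matrix B -> B \in unitmx.
Proof.
move=> HB; rewrite -unitmx_tr -row_free_unit -kermx_eq0.
(* [kermx] is a left kernel; taken for [B^T], its rows are the transposed kernel vectors of [B]. *)
set K := kermx _; have KB : B *m K^T = 0.
  by rewrite -[B]trmxK -trmx_mul mulmx_ker trmx0.
apply/eqP/row_matrixP => i; rewrite row0.
have rB : B *m col i K^T = 0 by rewrite colE mulmxA KB mul0mx.
have /(H_matrix_le HB) le0 :
    mx_le (comparison_mx B *m mx_abs (col i K^T)) (comparison_mx B *m 0).
  move=> k j; apply: le_trans (comparison_abs_le _ _ _ _) _.
  by rewrite rB mulmx0 !mxE normr0.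
apply/rowP => k; have := le0 k 0; rewrite !mxE => hk.
by apply/eqP; rewrite -normr_le0.
Qed.

Lemma mx_abs_leD u v i j : mx_abs (u + v) i j <= mx_abs u i j + mx_abs v i j.
Proof. by rewrite !mxE ler_normD. Qed.

Lemma mulmx_abs_le (C : 'M[R]_n) d v :
  mx_le (mx_abs d) v -> mx_le (mx_abs (C *m d)) (mx_abs C *m v).
Proof.
move=> dv i j; rewrite !mxE (le_trans (ler_norm_sum _ _ _))//.
apply: ler_sum => k _; rewrite normrM mxE; apply: ler_wpM2l => //.
by have := dv k j; rewrite mxE.
Qed.

Lemma mx_lt_ratio u v : mx_le 0 u -> mx_lt u v ->
  exists r : R, [/\ 0 <= r, r < 1 & mx_le u (r *: v)].
Proof.
(* The largest of finitely many ratios below 1; the default 0 gives [0 <= r] even when [n = 0]. *)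
move=> u0 uv; pose r := \big[Order.max/0]_i (u i 0 / v i 0).
have v0 i : 0 < v i 0.
  by apply: le_lt_trans (uv i 0); have := u0 i 0; rewrite mxE.
exists r; split; first exact: bigmax_ge_id.
  by apply: bigmax_lt => // i _; rewrite ltr_pdivrMr // mul1r.
move=> i j; rewrite ord1 mxE -ler_pdivrMr //; exact: le_bigmax.
Qed.

End ComparisonMatrix.

(** * Contractions in a weighted maximum norm *)

Section WeightedContraction.
Local Open Scope classical_set_scope.
Variables (R : realType) (n : nat).
Implicit Types w : 'cV[R]_n.

Lemma cvg_colP (x : nat -> 'cV[R]_n) (l : 'cV[R]_n) :
  (x k @[k --> \oo] --> l) <->
  (forall i, x k i 0 @[k --> \oo] --> l i 0).
Proof.
split=> [xl i|xl].
  exact: (cvg_comp _ (fun v : 'cV[R]_n => v i 0) xl (@coord_continuous _ _ _ i 0 l)).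
move=> A [P lP PA].
suff : \forall k \near \oo, forall i, P i 0 (x k i 0).
  by apply: filterS => k Pk; apply: PA => i j; rewrite ord1; exact: Pk.
by apply: filter_forall => i; exact: (xl i _ (lP i 0)).
Qed.

(** Finitely many positive weights give a norm equivalent to the sup norm; bounds by [e *: w]
    express it without defining it. *)
Lemma cvg_weightedP w (x : nat -> 'cV[R]_n) (l : 'cV[R]_n) : mx_lt 0 w ->
  (x k @[k --> \oo] --> l) <->
  (forall e, 0 < e -> \forall k \near \oo, mx_le (mx_abs (x k - l)) (e *: w)).
Proof.
move=> w0; have {}w0 i : 0 < w i 0 by have := w0 i 0; rewrite mxE.
rewrite cvg_colP; split=> [xl e e0|xl i].
  suff : \forall k \near \oo, forall i, `|x k i 0 - l i 0| <= e * w i 0.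
    by apply: filterS => k xk i j; rewrite ord1 !mxE; exact: xk.
  apply: filter_forall => i; move/cvgrPdist_le: (xl i).
  move=> /(_ (e * w i 0) (mulr_gt0 e0 (w0 i))).
  by apply: filterS => k; rewrite distrC.
apply/cvgrPdist_le => e e0.
apply: filterS (xl (e / w i 0) (divr_gt0 e0 (w0 i))) => k /(_ i 0).
by rewrite !mxE distrC divfK // gt_eqF.
Qed.

Lemma weighted_bound w (v : 'cV[R]_n) : mx_lt 0 w ->
  exists t : R, 0 <= t /\ mx_le (mx_abs v) (t *: w).
Proof.
move=> w0; have {}w0 i : 0 < w i 0 by have := w0 i 0; rewrite mxE.
exists (\big[Order.max/0]_i (`|v i 0| / w i 0)).
split; first exact: bigmax_ge_id.
move=> i j; rewrite ord1 !mxE -ler_pdivrMr //; exact: le_bigmax.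
Qed.

(** The telescoping series of [u] is dominated by a convergent geometric series. *)
Lemma geometric_increments_cvg (u : nat -> R) (a r : R) : 0 <= r -> r < 1 ->
  (forall k, `|u k.+1 - u k| <= a * r ^+ k) -> cvgn u.
Proof.
move=> r0 r1 ua.
have a0 : 0 <= a by have := ua 0%N; rewrite expr0 mulr1; exact: le_trans.
have ut : cvgn (series (telescope u)).
  apply: normed_cvg; apply: (@series_le_cvg _ _ (geometric a r)).
  - by move=> k; exact: normr_ge0.
  - by move=> k; rewrite /geometric /= mulr_ge0 ?exprn_ge0.
  - exact: ua.
  - by apply: is_cvg_geometric_series; rewrite ger0_norm.
have -> : u = (fun k => u 0%N + series (telescope u) k).
  by apply/funext => k; rewrite -eq_sum_telescope.
by apply: is_cvgD => //; exact: is_cvg_cst.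
Qed.

(** Banach's fixed point theorem, with completeness of [R] used entry by entry. *)
Lemma weighted_contraction_fixpoint w (r : R) (T : 'cV[R]_n -> 'cV[R]_n) :
  mx_lt 0 w -> 0 <= r -> r < 1 ->
  (forall t x y, mx_le (mx_abs (x - y)) (t *: w) ->
     mx_le (mx_abs (T x - T y)) ((r * t) *: w)) ->
  exists2 l, T l = l & forall x0, iter k T x0 @[k --> \oo] --> l.
Proof.
move=> w0 r0 r1 hT.
have hiter t k x y : mx_le (mx_abs (x - y)) (t *: w) ->
    mx_le (mx_abs (iter k T x - iter k T y)) ((t * r ^+ k) *: w).
  move=> xy; elim: k => [|k IH]; first by rewrite expr0 mulr1.
  by rewrite exprS mulrCA; exact: hT.
have [t [t0 ht]] := weighted_bound (T 0 - 0) w0.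
have iter_cvg i : cvgn (fun k => iter k T 0 i 0).
  apply: (@geometric_increments_cvg _ (t * w i 0) r) => // k.
  (* The increment at step [k] is the difference of the [k]-th iterates started at [T 0] and at
     [0]. *)
  have := hiter _ k _ _ ht i 0; rewrite -iterSr !mxE => /le_trans; apply.
  by rewrite mulrAC.
pose l : 'cV[R]_n := \col_i limn (fun k => iter k T 0 i 0).
have cvg_l : iter k T 0 @[k --> \oo] --> l.
  by apply/cvg_colP => i; rewrite mxE; exact: iter_cvg.
have Tl : T l = l.
  (* As [r <= 1], [T] keeps every bound [e *: w], so the shifted orbit tends to [T l] as well as to
     [l]. *)
  have cvg_Tl : iter k.+1 T 0 @[k --> \oo] --> T l.
    apply/(cvg_weightedP _ _ w0) => e e0.
    move/(cvg_weightedP _ _ w0)/(_ e e0): cvg_l; apply: filterS => k.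
    move=> /hT h i j; apply: le_trans (h i j) _; rewrite !mxE.
    have := w0 i j; rewrite mxE => wij.
    by apply: ler_wpM2r; [exact: ltW | rewrite ler_piMl // ltW].
  apply/colP => i; have /cvg_colP/(_ i) Tli := cvg_Tl.
  have /cvg_colP/(_ i) li := cvg_l; rewrite -cvg_shiftS /= in li.
  exact: (cvg_unique _ Tli li).
exists l => // x0; apply/(cvg_weightedP _ _ w0) => e e0.
(* The orbit of [x0] is compared with the constant orbit of [l]. *)
have [s [s0 hs]] := weighted_bound (x0 - l) w0.
have : geometric s r @ \oo --> (0 : R) by apply: cvg_geometric; rewrite ger0_norm.
move/cvgrPdist_le/(_ e e0); apply: filterS => k.
rewrite sub0r normrN /geometric /= => le_e i j.
have := hiter _ k _ _ hs i j; have -> : iter k T l = l by elim: k {le_e} => //= k ->.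
move/le_trans; apply; rewrite !mxE ler_wpM2r//.
  by have := w0 i j; rewrite mxE => /ltW.
exact: le_trans (ler_norm _) le_e.
Qed.

End WeightedContraction.

(** * Fixed points of the iteration and solutions of the LCP *)

Section ModulusReformulation.
Variables (R : realType) (n : nat).
Variables (A M N O1 O2 O4 : 'M[R]_n) (q : 'cV[R]_n) (g : R).
Hypotheses (hsplit : A = M - N) (hg : 0 < g) (hO4 : positive_diagonal O4).

Let fixed (x : 'cV[R]_n) := (M + O1 - O2 + g *: O4) *m x =
  (N + O1 - O2) *m x + (g *: O4 - A) *m mx_abs x - g *: q.

Lemma positive_diagonal_mulmxE (v : 'cV[R]_n) i : (O4 *m v) i 0 = O4 i i * v i 0.
Proof.
have [/diag_mxP[d ->] _] := hO4.
by rewrite mul_diag_mx !mxE eqxx.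
Qed.

Lemma fixed_modulusE x : fixed x <->
  A *m (g^-1 *: (mx_abs x + x)) + q = O4 *m (mx_abs x - x).
Proof.
have gN0 : g != 0 by rewrite gt_eqF.
have MNA : M = A + N by rewrite hsplit subrK.
(* The residuals of the two equations differ by the factor [g]: with [M = A + N], the terms in [N],
   [O1] and [O2] cancel. *)
have key : g *: (A *m (g^-1 *: (mx_abs x + x)) + q - O4 *m (mx_abs x - x)) =
   (M + O1 - O2 + g *: O4) *m x -
   ((N + O1 - O2) *m x + (g *: O4 - A) *m mx_abs x - g *: q).
  rewrite MNA -scalemxAr scalerBr scalerDr scalerA divff// scale1r.
  rewrite !mulmxDl !mulmxDr !mulNmx !mulmxN -!scalemxAl scalerBr.
  by apply/colP => i; rewrite !mxE; ring.
split=> [fx|eqx]; apply/eqP; rewrite -subr_eq0.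
  by have/eqP := key; rewrite fx subrr scaler_eq0 (negbTE gN0).
by rewrite -key eqx subrr scaler0.
Qed.

(** Signs come from [|x| >= x] and [|x| >= -x], complementarity from [(|x| + x) (|x| - x) = 0] in
    each entry. *)
Lemma fixed_LCP_solution x : fixed x ->
  LCP_solution q A (g^-1 *: (mx_abs x + x)).
Proof.
move=> /fixed_modulusE eqx; have [_ O4_gt0] := hO4.
exists (O4 *m (mx_abs x - x)); split=> // [i j|i j|].
- rewrite ord1 !mxE mulr_ge0 ?invr_ge0 1?(ltW hg)//.
  by have := ler_norm (- x i 0); rewrite normrN; lra.
- rewrite ord1 positive_diagonal_mulmxE !mxE mulr_ge0 1?(ltW (O4_gt0 i))//.
  by rewrite subr_ge0 ler_norm.
apply/matrixP => i j; rewrite !ord1 !mxE big1// => k _.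
rewrite positive_diagonal_mulmxE !mxE.
have abs2 : (`|x k 0| + x k 0) * (`|x k 0| - x k 0) = 0.
  by rewrite mulrC -subr_sqr real_normK ?num_real// subrr.
by rewrite (mulrC (O4 k k)) mulrA -[g^-1 * _ * _]mulrA abs2 mulr0 mul0r.
Qed.

(* x = (g z - O4^-1 w) / 2, so that |x| = (g z + O4^-1 w) / 2 by
   complementarity of z and w. *)
Lemma LCP_solution_fixed z : LCP_solution q A z ->
  exists2 x, fixed x & z = g^-1 *: (mx_abs x + x).
Proof.
move=> [w [wE z0 w0 zw]]; have [_ O4_gt0] := hO4.
have zi i : 0 <= z i 0 by have := z0 i 0; rewrite mxE.
have wi i : 0 <= w i 0 by have := w0 i 0; rewrite mxE.
(* A zero sum of nonnegative products has only zero terms. *)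
have zwi i : z i 0 * w i 0 = 0.
  have /matrixP/(_ 0 0) := zw; rewrite !mxE.
  under eq_bigr do rewrite mxE.
  by move/psumr_eq0P; apply=> // k _; rewrite mulr_ge0.
pose x : 'cV[R]_n := \col_i ((g * z i 0 - w i 0 / O4 i i) / 2).
have absx i : `|x i 0| = (g * z i 0 + w i 0 / O4 i i) / 2.
  have /eqP := zwi i; rewrite mulf_eq0 mxE normrM [`|2^-1|]ger0_norm ?invr_ge0//.
  case/orP => /eqP ->; rewrite ?mulr0 ?mul0r ?subr0 ?addr0 ?sub0r ?add0r ?normrN ger0_norm //.
    by rewrite divr_ge0 // ltW.
  by rewrite mulr_ge0 // ltW.
have zE : z = g^-1 *: (mx_abs x + x).
  apply/colP => i; have := absx i; rewrite !mxE => ->.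
  by field; rewrite !gt_eqF.
exists x => //; apply/fixed_modulusE; rewrite -zE -wE.
apply/colP => i; rewrite positive_diagonal_mulmxE //.
have := absx i; rewrite !mxE => ->.
by field; rewrite gt_eqF.
Qed.

End ModulusReformulation.

(** * Global convergence of the iteration *)

Theorem theorem4p4 (R : realType) (n : nat)
    (A M N O1 O2 O4 : 'M[R]_n) (q : 'cV[R]_n) (g : R)
    (hA : Hplus_matrix A)
    (hsplit : A = M - N)
    (hg : 0 < g)
    (hO4 : positive_diagonal O4) :
  let B := M + O1 - O2 + g *: O4 in
  let C := N + O1 - O2 in
  let G := g *: O4 - A in
  H_matrix B ->
  (exists w : 'cV[R]_n,
     mx_lt 0 w /\
     mx_lt ((mx_abs C + mx_abs G) *m w) (comparison_mx B *m w)) ->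
  forall x0 : 'cV[R]_n, RSMSM_converges A M N O1 O2 O4 g q x0.
Proof.
move=> B C G HB [w [w0 hw]] x0.
have Bu : B \in unitmx by exact: H_matrix_unit.
have [r [r0 r1 hr]] : exists r : R, [/\ 0 <= r, r < 1 &
    mx_le ((mx_abs C + mx_abs G) *m w) (r *: (comparison_mx B *m w))].
  apply: mx_lt_ratio hw => i j; rewrite !mxE; apply: sumr_ge0 => k _.
  by rewrite !mxE mulr_ge0 ?addr_ge0//; have := w0 k j; rewrite mxE => /ltW.
pose F x := C *m x + G *m mx_abs x - g *: q.
pose T x := invmx B *m F x.
have BT x : B *m T x = F x by rewrite mulKVmx.
have [l Tl cvg_l] : exists2 l, T l = l &
    forall y, (iter k T y @[k --> \oo] --> l)%classic.
  apply: (@weighted_contraction_fixpoint _ _ w r) => // t x y xy.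
  apply: (H_matrix_le HB) => i j.
  apply: le_trans (comparison_abs_le _ _ i j) _.
  have -> : B *m (T x - T y) = C *m (x - y) + G *m (mx_abs x - mx_abs y).
    rewrite mulmxBr !BT /F !mulmxBr; apply/colP => k; rewrite !mxE; ring.
  have Cle := mulmx_abs_le C xy i j.
  (* The modulus is 1-Lipschitz in each entry, so the term in [G] obeys the same bound as the term
     in [C]. *)
  have absxy : mx_le (mx_abs (mx_abs x - mx_abs y)) (t *: w).
    move=> k m; apply: le_trans (xy k m); rewrite !mxE; exact: ler_dist_dist.
  have Gle := mulmx_abs_le G absxy i j.
  (* The sign of [t] is read off from [0 <= |x - y| <= t w] at an entry, where [w] is positive. *)
  have t0 : 0 <= t.
    have := xy i j; have := w0 i j; rewrite !mxE => wij /(le_trans (normr_ge0 _)).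
    by rewrite pmulr_lge0.
  have -> : (comparison_mx B *m ((r * t) *: w)) i j =
      t * (r *: (comparison_mx B *m w)) i j.
    by rewrite -scalemxAr [LHS]mxE [in RHS]mxE mulrA (mulrC t).
  apply: le_trans (ler_wpM2l t0 (hr i j)).
  have -> : t * ((mx_abs C + mx_abs G) *m w) i j =
      (mx_abs C *m (t *: w)) i j + (mx_abs G *m (t *: w)) i j.
    by rewrite -!scalemxAr mulmxDl !mxE mulrDr.
  exact: le_trans (mx_abs_leD _ _ _ _) (lerD Cle Gle).
(* The orbit of such an [x] is constant, yet tends to [l]. This also yields uniqueness for the LCP,
   each of whose solutions comes from a fixed point. *)
have fixedT x : B *m x = F x -> x = l.
  move=> Bx; have Tx : T x = x by rewrite /T -Bx mulKmx.
  have itx k : iter k T x = x by elim: k => //= k ->.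
  have := cvg_l x; under eq_fun do rewrite itx.
  apply: cvg_unique; [exact: norm_hausdorff | exact: cvg_cst].
have fixl : B *m l = F l by rewrite -BT Tl.
split=> //; exists (g^-1 *: (mx_abs l + l)); split.
  split; first exact: (fixed_LCP_solution hsplit hg hO4 fixl).
  by move=> z /(LCP_solution_fixed O1 O2 hsplit hg hO4)[x /fixedT -> ->].
move=> x z [x00 xS zS].
(* Invertibility of [B] makes the implicit recursion the orbit of [T]. *)
have xE : x = fun k => iter k T x0.
  apply/funext; elim=> [//|k IH]; rewrite iterS -IH /T.
  by rewrite -[LHS](mulKmx Bu) xS.
have cvg_x : (x k @[k --> \oo] --> l)%classic by rewrite xE.
split; first by exists l.
(* The shift discards the unconstrained [z 0]; the rest is continuity of the modulus. *)
rewrite -cvg_shiftS; apply/cvg_colP => i.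
under eq_fun do rewrite /= zS !mxE.
rewrite !mxE.
have /cvg_colP/(_ i) xi : (x k.+1 @[k --> \oo] --> l)%classic by rewrite cvg_shiftS.
by apply: cvgMr; apply: cvgD => //; exact: cvg_norm.
Qed.
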